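(* Let $N\in\mathbb{N}^*$, $\sigma>0$, and let $W$ be an $N\times N$ random matrix with i.i.d. $\mathcal{N}(0,\sigma^2)$ entries. For $T\in\mathbb{N}^*$ let $B_{T,N}$ be its generalised matrix of moments of order $T$, with eigenvalues $\lambda_T(B_{T,N})\le\cdots\le\lambda_0(B_{T,N})=\lambda_{\max}(B_{T,N})$. Then for all $T\in\mathbb{N}^*$, \[\frac1{P(T)}\le\frac{\lambda_{\max}(B_{T,N})}{\sum_{i=0}^T\lambda_i(B_{T,N})}\le1,\qquad P(T)=\min\Big(T+1,\sum_{l=0}^T(\sigma^2N)^{-l}\Big).\] Moreover, there exists $T_{\sigma,N}\ge 6$ such that for all $T\ge T_{\sigma,N}$, \[\frac1{Q(T)}\le\frac{\lambda_{\max}(B_{T,N})}{\sum_{i=0}^T\lambda_i(B_{T,N})},\quad Q(T):=\min\Big(2,1+\frac1{\sigma^2N}\Big)\left(1+\frac{1}{2\left(\frac{\sigma^2}{N}\right)^2(T-3)}+\frac{T}{8\left(\frac{\sigma^2}{N}\right)^4(T-5)^2}\right).\]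
   Context: Generalised matrix of moments: for $i\in[N]$, $\beta_{i,0}=1$, $\beta_{i,l}=\sum_{i_1,\ldots,i_l=1}^N W_{ii_1}\cdots W_{i_{l-1}i_l}$ for $l\ge1$, and $B_{T,N}(l_1,l_2)=\mathbb{E}\sum_{i=1}^N\beta_{i,l_1}\beta_{i,l_2}$, $0\le l_1,l_2\le T$. *)

(* Defs.v *)
From HB Require Import structures.
From mathcomp Require Import all_boot all_order all_algebra.
From mathcomp Require Import all_classical all_reals all_analysis.
Set Implicit Arguments. Unset Strict Implicit. Unset Printing Implicit Defensive.
Import Order.TTheory GRing.Theory Num.Theory.
Local Open Scope classical_set_scope.
Local Open Scope ring_scope.

(* Mutual independence of a finite family of real random variables:
   product rule for all families of Borel sets (taking A i = setT for the
   indices not involved gives every finite subfamily). *)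
Definition mutually_independent d (Omega : measurableType d) (R : realType)
  (P : probability Omega R) (I : finType) (X : I -> Omega -> R) : Prop :=
  forall A : I -> set R, (forall i, measurable (A i)) ->
    P (\bigcap_(i in [set: I]) (X i @^-1` A i)) =
    (\prod_(i : I) P (X i @^-1` A i))%E.

(* X has law N(0, sigma^2) (normal_prob takes the standard deviation). *)
Definition has_normal_law d (Omega : measurableType d) (R : realType)
  (P : probability Omega R) (X : {RV P >-> R}) (sigma : R) : Prop :=
  forall A : set R, measurable A -> distribution P X A = normal_prob 0 sigma A.

(* beta_{i,l} = sum_{i_1..i_l} W_{i i_1} ... W_{i_{l-1} i_l}
   (l-fold product of the N x N matrix W applied to the all-ones vector). *)
Fixpoint beta (R : pzRingType) (N : nat) (W : 'I_N -> 'I_N -> R) (l : nat)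
  (i : 'I_N) : R :=
  match l with
  | 0 => 1
  | l'.+1 => \sum_(j < N) W i j * beta W l' j
  end.

Definition moment_matrix d (Omega : measurableType d) (R : realType)
  (P : probability Omega R) (N : nat) (W : 'I_N -> 'I_N -> {RV P >-> R})
  (T : nat) : 'M[R]_(T.+1) :=
  \matrix_(l1 < T.+1, l2 < T.+1)
     fine (expectation P (fun w => \sum_(i < N) beta (fun a b => W a b w) l1 i
                                      * beta (fun a b => W a b w) l2 i)).

Definition eigenvalues_seq (R : comNzRingType) (n : nat) (A : 'M[R]_n)
  (s : seq R) : Prop :=
  char_poly A = \prod_(x <- s) ('X - x%:P).

Definition seq_max (R : realDomainType) (s : seq R) : R :=
  \big[Num.max/head 0 s]_(x <- s) x.

Definition P_bound (R : realType) (sigma : R) (N T : nat) : R :=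
  Num.min (T.+1)%:R (\sum_(l < T.+1) ((sigma ^+ 2 * N%:R)^-1) ^+ l).

Definition Q_bound (R : realType) (sigma : R) (N T : nat) : R :=
  Num.min 2 (1 + (sigma ^+ 2 * N%:R)^-1) *
  (1 + (2 * (sigma ^+ 2 / N%:R) ^+ 2 * (T%:R - 3))^-1
     + T%:R / (8 * (sigma ^+ 2 / N%:R) ^+ 4 * (T%:R - 5) ^+ 2)).

(* Main.v *)
Require Import Defs.
From HB Require Import structures.
From mathcomp Require Import all_boot all_order all_algebra.
From mathcomp Require Import all_classical all_reals all_analysis.
From mathcomp Require Import measurable_realfun complex ring lra zify.
Set Implicit Arguments.
Unset Strict Implicit.
Unset Printing Implicit Defensive.
Import Order.TTheory GRing.Theory Num.Theory.
Import numFieldNormedType.Exports.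
Local Open Scope ring_scope.

(** Write b_l for the diagonal entry B(l, l). The matrix B is a Gram matrix, so
    its eigenvalues are nonnegative, they sum up to b_0 + ... + b_T, and the
    largest one is at least b_T. Everything follows from two growth estimates.

    By Wick's formula, b_l is sigma^(2l) times the number of triples consisting
    of two paths p, q of length l with a common starting point and of a perfect
    matching of their 2l edges in which matched edges are equal.

    - Prepending one common edge to p and q, matched with itself, gives
      b_(l+1) >= sigma^2 N b_l, hence the bound with P(T).
    - Append an edge to the end of p and one to the end of q, and match them with
      the two members x, y of an old matched pair, in one of the 2l possible
      ways. As equations on the N-valued labels of the vertices, this drops
      x = y and asks that the last vertex of p be the source of x and the last
      vertex of q the source of y. An equation between two labels divides the
      number of solutions by at most N, as the solutions form a subgroup of a
      power of Z/N. Hence N^2 b_(l+1) >= 2 l sigma^2 b_l.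

    Therefore b_0 + ... + b_T <= (1 + e) b_T for every e > 0 and large T, which is
    stronger than the bound with Q(T), because Q(T) >= min(2, 1 + 1/(sigma^2 N))
    and this minimum exceeds 1. *)

(** * Gaussian moments of words and sums over pairs of paths *)

(** Moments of the centred normal law of variance [v]. The recursion is the one that integration by
    parts yields; [normal_moment] identifies them with integrals. *)
Fixpoint gauss_moment (R : pzRingType) (v : R) (k : nat) : R :=
  match k with
  | 0 => 1
  | 1 => 0
  | k'.+2 => k'.+1%:R * v * gauss_moment v k'
  end.

(** At [k = 0] the factor [k%:R] vanishes, so the truncated predecessor is harmless and one
    recursion serves all orders. *)
Lemma gauss_momentS (R : pzRingType) (v : R) k :
  gauss_moment v k.+1 = k%:R * v * gauss_moment v k.-1.
Proof. by case: k => [|k] //=; rewrite mulr0n !mul0r. Qed.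

Lemma gauss_moment_ge0 (R : realDomainType) (v : R) k :
  0 <= v -> 0 <= gauss_moment v k.
Proof.
move=> v0; have [m] := ubnP k; elim: m k => // m IH [|[|k]] //= km.
by rewrite mulr_ge0 ?mulr_ge0 ?ler0n// IH// -ltnS ltnW.
Qed.

Definition del (T : Type) (k : nat) (s : seq T) := take k s ++ drop k.+1 s.

Lemma map_del (T U : Type) (f : T -> U) k s : map f (del k s) = del k (map f s).
Proof. by rewrite /del map_cat map_take map_drop. Qed.

Lemma size_del (T : Type) k (s : seq T) : (k < size s)%N ->
  size (del k s) = (size s).-1.
Proof.
move=> ks; rewrite size_cat size_drop size_take ks.
by case: (size s) ks => // n; rewrite ltnS subSS => /subnKC.
Qed.

Lemma perm_del (T : eqType) (x0 : T) k (s : seq T) : (k < size s)%N ->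
  perm_eq (nth x0 s k :: del k s) s.
Proof.
move=> ks; rewrite -[X in perm_eq _ X](cat_take_drop k) (drop_nth x0 ks).
by rewrite -cat1s perm_catCA.
Qed.

Lemma perm_rcons2 (T : eqType) (x y : T) s t :
  perm_eq (rcons s x ++ rcons t y) [:: x, y & s ++ t].
Proof.
by apply/permP => p; rewrite /= -!cats1 !count_cat /=; lia.
Qed.

(** * Wick contractions of words *)

Section wick.
Variables (R : realFieldType) (E : finType) (v : R).

(** Expectation of the product of the letters of [s], when the elements of [E] stand for independent
    centred normal variables of variance [v]. *)
Definition wick (s : seq E) : R := \prod_e gauss_moment v (count_mem e s).

Lemma wick_nil : wick [::] = 1.
Proof. by rewrite /wick big1. Qed.

Lemma wick_perm s t : perm_eq s t -> wick s = wick t.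
Proof. by move=> /permP st; apply: eq_bigr => e _; rewrite st. Qed.

Lemma wick_ge0 s : 0 <= v -> 0 <= wick s.
Proof. by move=> v0; apply: prodr_ge0 => e _; exact: gauss_moment_ge0. Qed.

(** Wick's recursion: the first letter is contracted with each equal letter of [s]. All these
    contractions contribute the same amount, and [gauss_momentS] supplies their number times [v]. *)
Lemma wick_cons x0 e s : wick (e :: s) =
  v * \sum_(k < size s) (nth x0 s k == e)%:R * wick (del k s).
Proof.
have -> : wick (e :: s) = (count_mem e s)%:R * v *
    (gauss_moment v (count_mem e s).-1 *
     \prod_(f | f != e) gauss_moment v (count_mem f s)).
  rewrite /wick (bigD1 e)//= eqxx add1n gauss_momentS -!mulrA; congr (_ * (_ * (_ * _))).
  by apply: eq_bigr => f fe; rewrite eq_sym (negbTE fe).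
rewrite (mulrC _ v) -mulrA; congr (v * _).
set c := _ * \prod_(_ | _) _.
transitivity (\sum_(k < size s) (nth x0 s k == e)%:R * c).
  rewrite -big_distrl/=; congr (_ * _).
  rewrite -natr_sum -sum1_count (big_nth x0) big_mkord big_mkcond/=.
  by congr (_%:R); apply: eq_bigr => k _; case: eqP.
apply: eq_bigr => k _; case: eqP => ske; last by rewrite !mul0r.
rewrite !mul1r /c /wick [in RHS](bigD1 e)//=.
have cnt f : count_mem f s = ((e == f) + count_mem f (del k s))%N.
  by rewrite -(permP (perm_del x0 (ltn_ord k)) (pred1 f)) /= ske.
rewrite cnt eqxx add1n; congr (_ * _).
by apply: eq_bigr => f fe; rewrite cnt eq_sym (negbTE fe).
Qed.

(** Contracting the two leading letters with each other is one term of Wick's recursion; the other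
    terms are nonnegative. *)
Lemma wick_cons2 e s : 0 <= v -> v * wick s <= wick [:: e, e & s].
Proof.
move=> v0; rewrite (wick_cons e) ler_wpM2l//= big_ord_recl/= eqxx mul1r /del/=.
rewrite drop0 lerDl sumr_ge0// => i _.
by rewrite mulr_ge0 ?ler0n ?wick_ge0.
Qed.


End wick.

(** Joins the finite and the group structure of a product, so that [path_pairs] can enlarge its
    group by two free vertices. *)
HB.instance Definition _ (G H : finZmodType) := GRing.Zmodule.on (G * H)%type.

(** * Gluing vertices in words of homomorphisms *)

Section gluing.
Variables (R : realFieldType) (n : nat) (G : finZmodType) (v : R).
Hypothesis v0 : 0 <= v.
Local Notation Z := ('I_n.+1).
Local Notation hom := {additive G -> Z}.
Implicit Types (a b : hom) (w : seq (hom * hom)) (S : {set G}).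

(** An element [g] is a labelling of the vertices by [Z]; a vertex is a homomorphism and an edge a
    pair of vertices. *)
Definition word_at (g : G) w : seq (Z * Z) := [seq (e.1 g, e.2 g) | e : hom * hom <- w].

Lemma size_word_at g w : size (word_at g w) = size w.
Proof. exact: size_map. Qed.

Lemma word_at_del g w k : del k (word_at g w) = word_at g (del k w).
Proof. by rewrite /word_at map_del. Qed.

Definition equalizer S a b := [set g in S | a g == b g].

Lemma equalizer_closed S a b : zmod_closed S -> zmod_closed (equalizer S a b).
Proof.
move=> [S0 SB]; split=> [|x y]; first by rewrite inE S0 !raddf0 eqxx.
rewrite !inE => /andP[xS /eqP ax] /andP[yS /eqP ay].
by rewrite SB// !raddfB ax ay eqxx.
Qed.

(** The values of [a - b] split [S] into at most [n.+1] nonempty fibres, and a translation carries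
    each of them into the equalizer. *)
Lemma card_equalizer S a b : zmod_closed S ->
  (#|S| <= n.+1 * #|equalizer S a b|)%N.
Proof.
move=> [S0 SB]; rewrite -sum1_card (partition_big (fun g => a g - b g) predT)//=.
apply: (@leq_trans (\sum_(c : Z) #|equalizer S a b|)%N); last first.
  by rewrite sum_nat_const card_ord.
apply: leq_sum => c _; rewrite sum1dep_card.
set F := [set _ | _]; have [->|[g0]] := set_0Vmem F; first by rewrite cards0.
rewrite !inE => g0P; move: (g0P) => /andP[g0S /eqP g0c].
rewrite -(card_imset (mem F) (@addIr _ (- g0))); apply: subset_leq_card.
apply/fintype.subsetP => _ /imsetP[g gF ->]; move: gF; rewrite inE => /andP[gS /eqP gc].
rewrite inE SB// !raddfB -subr_eq0 /=.
by rewrite opprD addrACA -opprD gc g0c subrr.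
Qed.

Definition same_edge S (e f : hom * hom) :=
  equalizer (equalizer S e.1 f.1) e.2 f.2.

(** Wick's recursion summed over [S]: the condition that contracted edges agree moves from an
    indicator into the range of summation. *)
Lemma word_sum S e w e0 : \sum_(g in S) wick v (word_at g (e :: w)) =
    v * \sum_(k < size w) \sum_(g in same_edge S (nth e0 w k) e)
      wick v (word_at g (del k w)).
Proof.
  rewrite big_distrr/=; under [RHS]eq_bigr do rewrite big_mkcond/=.
  rewrite -big_distrr/= exchange_big/= big_distrr/= big_mkcond/=.
  apply: eq_bigr => g _; case: ifPn => gS; last first.
    rewrite big1 ?mulr0// => k _; rewrite /same_edge !inE.
    by rewrite (negbTE gS).
  rewrite (wick_cons v (e.1 g, e.2 g)) size_word_at; congr (_ * _).
  apply: eq_bigr => k _; rewrite word_at_del (nth_map e0)// /same_edge !inE gS/=.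
  by rewrite xpair_eqE; case: ifP; rewrite ?mul1r ?mul0r.
Qed.

(* Wick contractions only add equalities to [S], which reduces the claim to the
   empty word, that is, to the index of the kernel of [a - b] on [S]. *)
Lemma gluing w S a b : zmod_closed S ->
  \sum_(g in S) wick v (word_at g w)
    <= n.+1%:R * \sum_(g in equalizer S a b) wick v (word_at g w).
Proof.
have [m] := ubnP (size w); elim: m w S => // m IH [|e w] S /= wm cS.
  under eq_bigr do rewrite wick_nil; under [X in _ * X]eq_bigr do rewrite wick_nil.
  rewrite !sumr_const -natrM ler_nat; exact: card_equalizer.
have sE S' f : same_edge (equalizer S' a b) f e = equalizer (same_edge S' f e) a b.
  by apply/setP => g; rewrite !inE; do ![case: (_ \in _) | case: (_ == _)].
rewrite !(word_sum _ e w e) mulrCA ler_wpM2l// big_distrr/= ler_sum// => k _.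
rewrite sE; apply: IH; last exact/equalizer_closed/equalizer_closed.
by rewrite size_del// (leq_ltn_trans (leq_pred _)).
Qed.


(** As [wick] ignores the order of letters, the recursion may start at any of them. Doing so at
    every letter turns the factor [size w] into a sum over ordered contracted pairs; [j] indexes the
    word without its letter [k]. *)
Lemma sum_wick_size w e0 S : (size w)%:R * \sum_(g in S) wick v (word_at g w) =
  v * \sum_(k < size w) \sum_(j < (size w).-1)
    \sum_(g in same_edge S (nth e0 (del k w) j) (nth e0 w k))
      wick v (word_at g (del j (del k w))).
Proof.
rewrite mulr_natl -[X in _ *+ X]card_ord -sumr_const big_distrr/=.
apply: eq_bigr => k _; have := word_sum S (nth e0 w k) (del k w) e0.
rewrite size_del// => <-; apply: eq_bigr => g _; apply: wick_perm.
rewrite perm_sym.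
rewrite /= -word_at_del.
rewrite -(nth_map e0 (e0.1 g, e0.2 g) (fun e : hom * hom => (e.1 g, e.2 g)))//.
by apply: perm_del; rewrite size_word_at.
Qed.

(** Among all contractions, keep those of the new edges with two distinct old letters. Summing over
    the free targets [c] and [d] leaves only conditions on sources. *)
Lemma wick_extend (x0 : Z * Z) (a b : Z) s :
  v ^+ 2 * \sum_(k < size s) \sum_(j < (size s).-1)
     ((nth x0 s k).1 == a)%:R * ((nth x0 (del k s) j).1 == b)%:R
       * wick v (del j (del k s))
   <= \sum_c \sum_d wick v [:: (a, c), (b, d) & s].
Proof.
have proj (x : Z * Z) (y : Z) : \sum_c (x == (y, c))%:R = (x.1 == y)%:R :> R.
  rewrite (bigD1 x.2)//= [x in (x == _)%:R]surjective_pairing xpair_eqE eqxx andbT.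
  rewrite big1 ?addr0// => c cx; rewrite [x in (x == _)%:R]surjective_pairing.
  by rewrite xpair_eqE andbC [_ == c]eq_sym (negbTE cx).
apply: (@le_trans _ _ (v * \sum_c \sum_d \sum_(k < size s)
    (nth x0 s k == (a, c))%:R * wick v ((b, d) :: del k s))); last first.
  rewrite big_distrr ler_sum//= => c _; rewrite big_distrr ler_sum//= => d _.
  (* The head term dropped here contracts the two new edges with each other. *)
  rewrite [leRHS](wick_cons v x0) ler_wpM2l// big_ord_recl/= lerDr.
  by rewrite mulr_ge0 ?ler0n ?wick_ge0.
rewrite expr2 -mulrA ler_wpM2l//.
under [leRHS]eq_bigr do rewrite exchange_big/=.
rewrite [leRHS]exchange_big/= big_distrr/= ler_sum// => k _.
under [leRHS]eq_bigr do rewrite -big_distrr/=.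
rewrite -big_distrl/= proj.
under [X in _ <= _ * X]eq_bigr => d _ do
  rewrite (wick_cons v x0) size_del//.
rewrite -[X in _ <= _ * X]big_distrr/= [X in _ <= _ * (_ * X)]exchange_big/= mulrCA.
rewrite ler_wpM2l// big_distrr/= ler_sum// => j _.
by rewrite -mulrA ler_wpM2l ?ler0n// -big_distrl/= proj.
Qed.

(* Contracting the two new edges with the edges [k] and [j] of [w] leaves two
   equalities of vertices, each of which costs a factor [n.+1] by [gluing]. *)
Lemma wick_extend_growth w (a b : hom) :
  v * (size w)%:R * \sum_g wick v (word_at g w) <=
  n.+1%:R ^+ 2 * \sum_g \sum_c \sum_d wick v [:: (a g, c), (b g, d) & word_at g w].
Proof.
(* The empty word offers no default edge for [nth], but its left-hand side is 0. *)
case: w => [|e0 w'].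
  rewrite mulr0 mul0r mulr_ge0// ?exprn_ge0// !sumr_ge0// => g _.
  by rewrite sumr_ge0// => c _; rewrite sumr_ge0// => d _; exact: wick_ge0.
move: (e0 :: w') => w.
pose x0 g : Z * Z := (e0.1 g, e0.2 g).
apply: (@le_trans _ _ (n.+1%:R ^+ 2 * \sum_g (v ^+ 2 *
    \sum_(k < size w) \sum_(j < (size w).-1)
     ((nth (x0 g) (word_at g w) k).1 == a g)%:R
      * ((nth (x0 g) (word_at g (del k w)) j).1 == b g)%:R
       * wick v (word_at g (del j (del k w)))))); last first.
  rewrite ler_wpM2l ?exprn_ge0// ler_sum// => g _.
  have := wick_extend (x0 g) (a g) (b g) (word_at g w); rewrite size_word_at.
  by under eq_bigr do under eq_bigr do rewrite !word_at_del.
rewrite -mulrA -big_distrr/= [leRHS]mulrCA [v ^+ 2]expr2 -[leRHS]mulrA ler_wpM2l//.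
have -> : \sum_g wick v (word_at g w) = \sum_(g in [set: G]) wick v (word_at g w).
  by apply: eq_bigl => g; rewrite inE.
rewrite (sum_wick_size w e0) ler_wpM2l// [X in _ * X]exchange_big/= big_distrr/=.
rewrite ler_sum// => k _.
rewrite [X in _ * X]exchange_big/= big_distrr/= ler_sum// => j _.
(* The old pair is released: forgetting that its two edges agree only adds nonnegative terms. *)
apply: (@le_trans _ _ (\sum_(g in [set: G]) wick v (word_at g (del j (del k w))))).
  rewrite [leRHS]big_mkcond [leLHS]big_mkcond; apply: ler_sum => g _.
  by rewrite finset.in_setT; case: ifP => // _; exact: wick_ge0.
have cT : zmod_closed [set: G] by split=> [|x y]; rewrite !inE.
apply: (le_trans (gluing _ (nth e0 w k).1 a cT)); rewrite expr2 -mulrA ler_wpM2l//.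
apply: (le_trans (gluing _ (nth e0 (del k w) j).1 b (equalizer_closed _ _ cT))).
rewrite ler_wpM2l// big_mkcond ler_sum// => g _.
rewrite !(nth_map e0) ?size_del// !inE/=.
by case: (_ == _); case: (_ == _); rewrite /= ?mul1r ?mul0r ?mulr0.
Qed.

End gluing.

(** * Sums over paths *)

Section path_sums.
Variables (R : realFieldType) (N : nat).
Local Notation Z := ('I_N).
Local Notation word := (seq (Z * Z)).
Implicit Types (F : word -> Z -> R).

(* The sum of [F s j] over the paths of length [l] from [i], where [s] is the
   list of edges of the path and [j] its endpoint. *)
Fixpoint path_sum l (i : Z) F : R :=
  match l with
  | 0 => F [::] i
  | l'.+1 => \sum_j path_sum l' j (fun s => F ((i, j) :: s))
  end.

Lemma eq_path_sum l i F F' : (forall s j, F s j = F' s j) ->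
  path_sum l i F = path_sum l i F'.
Proof.
elim: l i F F' => [|l IH] i F F' FF' //=.
by apply: eq_bigr => j _; apply: IH => s k; rewrite FF'.
Qed.

Lemma path_sum_ge0 l i F : (forall s j, 0 <= F s j) -> 0 <= path_sum l i F.
Proof.
elim: l i F => [|l IH] i F F0 //=.
by apply: sumr_ge0 => j _; apply: IH => s k; rewrite F0.
Qed.

Lemma ler_path_sum l i F F' : (forall s j, F s j <= F' s j) ->
  path_sum l i F <= path_sum l i F'.
Proof.
elim: l i F F' => [|l IH] i F F' FF' //=.
by apply: ler_sum => j _; apply: IH => s k; rewrite FF'.
Qed.

Lemma path_sumZ l i c F : path_sum l i (fun s j => c * F s j) = c * path_sum l i F.
Proof.
elim: l i F => [|l IH] i F //=; rewrite big_distrr/=.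
by apply: eq_bigr => j _; rewrite IH.
Qed.

Lemma path_sum_sum (I : finType) l i (F : I -> word -> Z -> R) :
  path_sum l i (fun s j => \sum_x F x s j) = \sum_x path_sum l i (F x).
Proof.
elim: l i F => [|l IH] i F //=.
by under eq_bigr do rewrite IH; rewrite exchange_big.
Qed.

(** [path_sum] recurses on the first edge, whereas two paths with a common start have to be extended
    at their ends. *)
Lemma path_sum_rcons l i F : path_sum l.+1 i F =
  path_sum l i (fun s j => \sum_c F (rcons s (j, c)) c).
Proof.
elim: l i F => [|l IH] i F //.
by apply: eq_bigr => j _; exact: (IH j (fun s => F ((i, j) :: s))).
Qed.

End path_sums.

Lemma beta_path_sum (R : realFieldType) N (W : 'I_N -> 'I_N -> R) l i :
  beta W l i = path_sum l i (fun s _ => \prod_(e <- s) W e.1 e.2).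
Proof.
elim: l i => [|l IH] i /=; first by rewrite big_nil.
apply: eq_bigr => j _; rewrite IH -path_sumZ.
by apply: eq_path_sum => s k; rewrite big_cons.
Qed.

(** The value of the entry [(l1, l2)] of the moment matrix by Wick's formula, as [moment_matrixE]
    confirms. *)
Definition wick_moment (R : realFieldType) (N : nat) (v : R) (l1 l2 : nat) : R :=
  \sum_(i < N) path_sum l1 i (fun s _ => path_sum l2 i (fun t _ => wick v (s ++ t))).

(** * Growth of the diagonal moments *)

Section moment_growth.
Variables (R : realFieldType) (n : nat) (v : R).
Hypothesis v0 : 0 <= v.
Local Notation Z := ('I_n.+1).
Local Notation word := (seq (Z * Z)).

(* The pairs of paths of length [l] with a common starting point are encoded by a
   group [G] on which each vertex is a homomorphism; [a] and [b] are the
   endpoints. *)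
Lemma path_pairs l : exists (G : finZmodType)
    (w : seq ({additive G -> Z} * {additive G -> Z})) (a b : {additive G -> Z}),
  size w = l.*2 /\
  forall F : word -> Z -> Z -> R,
    (forall s t i j, perm_eq s t -> F s i j = F t i j) ->
    \sum_i path_sum l i (fun s j => path_sum l i (fun t k => F (s ++ t) j k))
      = \sum_g F (word_at g w) (a g) (b g).
Proof.
elim: l => [|l [G [w [a [b [sw FE]]]]]].
  (* At length 0 there is a single free vertex, which is the endpoint of both paths. *)
  exists Z, [::], idfun, idfun; split => //.
pose f1 : {additive (G * Z * Z)%type -> G} := (fst \o fst).
pose f2 : {additive (G * Z * Z)%type -> Z} := (snd \o fst).
pose f3 : {additive (G * Z * Z)%type -> Z} := snd.
pose lift (h : {additive G -> Z}) : {additive (G * Z * Z)%type -> Z} := h \o f1.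
exists ((G * Z * Z)%type : finZmodType), [:: (lift a, f2), (lift b, f3) &
  [seq (lift e.1, lift e.2) | e : {additive G -> Z} * {additive G -> Z} <- w]], f2, f3.
split=> [|F Fp]; first by rewrite /= size_map sw doubleS.
(* [F'] absorbs the two new last edges so that the induction hypothesis applies; invariance of [F]
   under permutations lets them move to the front. *)
pose F' s i j := \sum_c \sum_d F [:: (i, c), (j, d) & s] c d.
have F'p s t i j : perm_eq s t -> F' s i j = F' t i j.
  move=> st; apply: eq_bigr => c _; apply: eq_bigr => d _; apply: Fp.
  by rewrite !perm_cons.
transitivity (\sum_g F' (word_at g w) (a g) (b g)).
  rewrite -FE//; apply: eq_bigr => i _; rewrite path_sum_rcons.
  apply: eq_path_sum => s j; rewrite path_sum_sum; apply: eq_bigr => c _.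
  rewrite path_sum_rcons; apply: eq_path_sum => t k; apply: eq_bigr => d _.
  by apply: Fp; exact: perm_rcons2.
rewrite /F'; under eq_bigr do rewrite pair_bigA/=.
rewrite pair_bigA/=; rewrite (reindex (fun g : G * Z * Z => (g.1.1, (g.1.2, g.2))))/=.
  apply: eq_bigr => g _; congr (F (_ :: _ :: _) _ _).
  by rewrite /word_at -map_comp; apply: eq_map.
by exists (fun g => (g.1, g.2.1, g.2.2)) => [[[]]|[? []]].
Qed.

Lemma wick_moment0 : wick_moment n.+1 v 0 0 = n.+1%:R.
Proof.
by rewrite /wick_moment/=; under eq_bigr do rewrite wick_nil; rewrite sumr_const card_ord.
Qed.

(** Keep the pairs of paths with the same first edge and contract its two copies, for a factor [v];
    the new starting vertex is free, for a factor [n.+1]. *)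
Lemma wick_moment_prepend l :
  v * n.+1%:R * wick_moment n.+1 v l l <= wick_moment n.+1 v l.+1 l.+1.
Proof.
rewrite mulrAC mulr_natr -[X in _ *+ X]card_ord -sumr_const.
apply: ler_sum => i _ /=; rewrite big_distrr/=; apply: ler_sum => j _.
rewrite -path_sumZ; apply: ler_path_sum => s _.
rewrite (bigD1 j)//= ler_wpDr//; last first.
  rewrite -path_sumZ; apply: ler_path_sum => t _.
  rewrite (le_trans (wick_cons2 (i, j) _ v0))//.
  rewrite le_eqVlt; apply/orP; left; apply/eqP/wick_perm/permP => p.
  by rewrite /= !count_cat/=; lia.
by apply: sumr_ge0 => k _; apply: path_sum_ge0 => t _; exact: wick_ge0.
Qed.

(** [path_pairs] turns both moments into sums over one group, with a word of [l.*2] edges, to which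
    [wick_extend_growth] applies. *)
Lemma wick_moment_append l :
  v * l.*2%:R * wick_moment n.+1 v l l
    <= n.+1%:R ^+ 2 * wick_moment n.+1 v l.+1 l.+1.
Proof.
have [G [w [a [b [sw FE]]]]] := path_pairs l.
pose F' (s : word) (i j : Z) : R :=
  \sum_(c : Z) \sum_(d : Z) wick v [:: (i, c), (j, d) & s].
have F'p s t i j : perm_eq s t -> F' s i j = F' t i j.
  move=> st; apply: eq_bigr => c _; apply: eq_bigr => d _; apply: wick_perm.
  by rewrite !perm_cons.
have -> : wick_moment n.+1 v l.+1 l.+1 = \sum_g F' (word_at g w) (a g) (b g).
  rewrite -FE//; apply: eq_bigr => i _; rewrite path_sum_rcons.
  apply: eq_path_sum => s j; rewrite path_sum_sum; apply: eq_bigr => c _.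
  rewrite path_sum_rcons; apply: eq_path_sum => t k; apply: eq_bigr => d _.
  by apply: wick_perm; exact: perm_rcons2.
rewrite [wick_moment _ _ _ _](FE (fun s _ _ => wick v s)); last first.
  by move=> s t _ _; exact: wick_perm.
by rewrite -sw; exact: wick_extend_growth.
Qed.

End moment_growth.

(** * Eigenvalues of real symmetric matrices *)

Section eigenvalues.
Variables (R : rcfType) (m : nat) (A : 'M[R]_m.+1) (s : seq R).
Hypothesis As : eigenvalues_seq A s.

Lemma size_eigenvalues : size s = m.+1.
Proof.
by have := size_char_poly A; rewrite As size_prod_XsubC => -[].
Qed.

(** Both sides are the opposite of the coefficient of degree [m] of the characteristic
    polynomial. *)
Lemma sum_eigenvalues : \sum_(x <- s) x = \tr A.
Proof.
have := char_poly_trace A (ltn0Sn m); rewrite As -[X in _`_X.-1]size_eigenvalues.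
by rewrite coefPn_prod_XsubC ?size_eigenvalues// => /oppr_inj.
Qed.

Lemma eigenvalues_ge0 : (forall u : 'rV_m.+1, 0 <= (u *m A *m u^T) 0 0) ->
  forall x, x \in s -> 0 <= x.
Proof.
move=> psd x; rewrite -root_prod_XsubC -As -eigenvalue_root_char.
(* At a left eigenvector [u] the quadratic form is [x] times the squared norm of [u], which is
   positive. *)
move=> /eigenvalueP[u uA u0]; have := psd u; rewrite uA -scalemxAl mxE.
rewrite pmulr_lge0// mxE lt_neqAle eq_sym sumr_ge0/= ?andbT => [|i _]; last first.
  by rewrite mxE -expr2 sqr_ge0.
apply: contra u0 => /eqP /psumr_eq0P u0; apply/eqP/rowP => i; rewrite mxE.
have := u0 _ i isT; rewrite mxE => /(_ _)/eqP.
by rewrite mulf_eq0 orbb => u0'; apply/eqP/u0' => j _; rewrite mxE -expr2 sqr_ge0.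
Qed.

Lemma le_seq_max x : x \in s -> x <= seq_max s.
Proof. by move=> xs; exact: le_bigmax_seq. Qed.

Lemma sum_le_seq_max : \sum_(x <- s) x <= m.+1%:R * seq_max s.
Proof.
rewrite -size_eigenvalues mulr_natl -iter_addr_0 -count_predT -big_const_seq.
rewrite [leLHS]big_seq [leRHS]big_seq ler_sum// => x.
exact: le_seq_max.
Qed.

Lemma seq_max_le_sum : (forall x, x \in s -> 0 <= x) -> seq_max s <= \sum_(x <- s) x.
Proof.
move=> s0; have le x : x \in s -> x <= \sum_(y <- s) y.
  move=> xs; rewrite (big_rem x)//= lerDl big_seq sumr_ge0// => y /mem_rem.
  exact: s0.
rewrite /seq_max big_seq.
apply: (@big_ind _ (fun z => z <= \sum_(x <- s) x)) => [|x y xs ys|//].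
  (* The default [head 0 s] of the maximum is itself an eigenvalue, since [s] is not empty. *)
  by apply: le; have := size_eigenvalues; case: (s) => //= x s' _; rewrite mem_head.
by rewrite ge_max xs.
Qed.

Local Open Scope complex_scope.
Local Open Scope sesquilinear_scope.

(** By the spectral theorem over [R[i]], [A i i] is an average of eigenvalues with weights
    [|P k i|^2], which sum to 1 because [P] is unitary. *)
Lemma diag_le_seq_max i : A^T = A -> A i i <= seq_max s.
Proof.
move=> Asym; pose C := [the numClosedFieldType of R[i]].
pose B : 'M[C]_m.+1 := map_mx (real_complex R) A.
have realC (x : R) : x%:C \is Num.real by rewrite complex_real.
have Bherm : B \is hermsymmx.
  apply: realsym_hermsym; last by apply/mxOverP => j k; rewrite mxE; exact: realC.
  apply/is_hermitianmxP; rewrite expr0 scale1r map_mx_id//.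
  by apply/matrixP => j k; rewrite !mxE -[in LHS]Asym mxE.
have /hermitian_normalmx /orthomx_spectralP := Bherm.
set P := spectralmx B; set d := spectral_diag B => BE.
have PU : P \is unitarymx := spectral_unitarymx B.
have Pu : P \in unitmx := spectral_unit B.
(* The rows of [P] are left eigenvectors of [B], so each [d 0 k] is a root of the characteristic
   polynomial and hence a member of [s]. *)
have dle k : d 0 k <= (seq_max s)%:C.
  have : root (char_poly B) (d 0 k).
    rewrite -eigenvalue_root_char; apply/eigenvalueP; exists (row k P).
      rewrite -row_mul BE mulmxA mulmxA mulmxV// mul1mx.
      by apply/rowP => j; rewrite mxE mul_diag_mx !mxE.
    apply/negP => /eqP P0; have := row_mul k P (invmx P).
    rewrite mulmxV// P0 mul0mx => /rowP/(_ k); rewrite !mxE eqxx => /eqP.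
    by rewrite oner_eq0.
  rewrite -map_char_poly As rmorph_prod/=.
  under eq_bigr do rewrite rmorphB/= map_polyX map_polyC/=.
  rewrite -(big_map (real_complex R) xpredT (fun x => 'X - x%:P)).
  rewrite root_prod_XsubC => /mapP[x xs ->]; rewrite lecR; exact: le_seq_max.
have Bii : B i i = \sum_k `|P k i| ^+ 2 * d 0 k.
  rewrite BE invmx_unitary// mxE; apply: eq_bigr => k _.
  rewrite mul_mx_diag !mxE normCK; ring.
have P1 : \sum_k `|P k i| ^+ 2 = 1.
  have := mulVmx Pu; rewrite invmx_unitary// => /matrixP/(_ i i).
  rewrite [RHS]mxE eqxx mulr1n mxE => <-; apply: eq_bigr => k _.
  by rewrite !mxE normCK mulrC.
rewrite -lecR; have -> : (A i i)%:C = B i i by rewrite mxE.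
rewrite Bii -[leRHS]mul1r -P1 big_distrl/= ler_sum// => k _.
by rewrite ler_wpM2l// exprn_ge0.
Qed.

End eigenvalues.

(** * Expectation of products of independent variables *)

Local Open Scope classical_set_scope.
Local Open Scope ring_scope.

Section integral_density.
Import HBNNSimple.
Local Open Scope ereal_scope.
Context d1 d2 (S : measurableType d1) (T : measurableType d2) (R : realType).
Variables (mu : {measure set S -> \bar R}) (nu : {measure set T -> \bar R}).
Variables (X : S -> T) (h : S -> R).
Hypotheses (mX : measurable_fun setT X) (mh : measurable_fun setT h).
Hypothesis h0 : forall x, (0 <= h x)%R.
Hypothesis nuE : forall A, measurable A ->
  \int[mu]_x (h x * \1_A (X x))%:E = nu A.

Lemma ge0_integral_density (g : T -> R) : measurable_fun setT g ->
  (forall y, (0 <= g y)%R) ->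
  \int[mu]_x (h x * g (X x))%:E = \int[nu]_y (g y)%:E.
Proof.
move=> mg g0.
have mEg : measurable_fun setT (fun y => (g y)%:E) by exact/measurable_EFinP.
pose f := nnsfun_approx measurableT mEg.
have fg y : (f n y)%:E @[n --> \oo] --> (g y)%:E.
  by apply: (@cvg_nnsfun_approx _ _ _ _ measurableT _ mEg) => // ? _; rewrite lee_fin.
have ndf m n y : (m <= n)%N -> (f m y <= f n y)%R.
  by move=> mn; exact/lefP/nd_nnsfun_approx.
have mhf n : measurable_fun setT (fun x => h x * f n (X x))%R.
  by apply: measurable_funM => //; exact: measurableT_comp.
have -> : \int[nu]_y (g y)%:E = limn (fun n => \int[nu]_y (f n y)%:E).
  rewrite -monotone_convergence//.
  - by apply: eq_integral => y _; apply/esym/cvg_lim.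
  - by move=> n; exact/measurable_EFinP.
  - by move=> n y _; rewrite lee_fin.
  - by move=> y _ m n mn; rewrite lee_fin ndf.
have -> : \int[mu]_x (h x * g (X x))%:E
    = limn (fun n => \int[mu]_x (h x * f n (X x))%:E).
  rewrite -monotone_convergence//.
  - apply: eq_integral => x _; apply/esym/cvg_lim => //.
    under eq_fun do rewrite EFinM.
    by rewrite EFinM; apply: cvgeZl.
  - by move=> n; exact/measurable_EFinP.
  - by move=> n x _; rewrite lee_fin mulr_ge0.
  - by move=> x _ m n mn; rewrite lee_fin ler_wpM2l ?ndf.
congr (lim (_ @ \oo)); apply/funext => n.
have mind r : measurable (f n @^-1` [set r]) by [].
transitivity (\sum_(r \in range (f n)) (r%:E * nu (f n @^-1` [set r]))); last first.
  rewrite [RHS](_ : _ = \int[nu]_y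
      \sum_(r \in range (f n)) (r * \1_(f n @^-1` [set r]) y)%:E).
    rewrite ge0_integral_fsum//; last 2 first.
    - by move=> r; exact/measurable_EFinP/measurable_funM.
    - by move=> r y _; rewrite nnfun_muleindic_ge0.
    by apply: eq_fsbigr => r _; rewrite integralZl_indic_nnsfun// integral_indic//= setIT.
  by apply: eq_integral => y _; rewrite fsumEFin// -fimfunE.
rewrite (_ : \int[mu]_x _ = \int[mu]_x \sum_(r \in range (f n))
    (r * (h x * \1_(f n @^-1` [set r]) (X x)))%:E); last first.
  apply: eq_integral => x _; rewrite fsumEFin// [in LHS]fimfunE; congr EFin.
  by rewrite mulr_fsumr; apply: eq_fsbigr => r _; rewrite mulrCA.
have mi r : measurable_fun setT (fun x => h x * \1_(f n @^-1` [set r]) (X x))%R.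
  by apply: measurable_funM => //; apply: measurableT_comp => //.
have ri0 r x : 0 <= (r * (h x * \1_(f n @^-1` [set r]) (X x)))%:E.
  by rewrite mulrCA EFinM mule_ge0 ?lee_fin// -lee_fin nnfun_muleindic_ge0.
rewrite ge0_integral_fsum//; last first.
  by move=> r; exact/measurable_EFinP/measurable_funM.
apply: eq_fsbigr => r; rewrite inE => -[y _ <-].
under eq_integral do rewrite EFinM.
rewrite ge0_integralZl//; last 3 first.
- exact/measurable_EFinP.
- by move=> x _; rewrite lee_fin mulr_ge0.
- by rewrite lee_fin.
by rewrite nuE.
Qed.

End integral_density.

Section independence.
Context d (Omega : measurableType d) (R : realType) (P : probability Omega R).
Variables (I : finType) (X : I -> {RV P >-> R}).
Hypothesis indX : mutually_independent P (fun i => X i : Omega -> R).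

Local Notation Ex f := (fine (\int[P]_w (f w)%:E)%E).

Let comp_measurable (f : I -> R -> R) i :
  measurable_fun setT (f i) -> measurable_fun setT (fun w => f i (X i w)).
Proof. by move=> mf; exact: measurableT_comp. Qed.

Let prod_measurable (f : I -> R -> R) (Q : pred I) :
  (forall i, measurable_fun setT (f i)) ->
  measurable_fun setT (fun w => \prod_(i | Q i) f i (X i w)).
Proof.
move=> mf; elim: (index_enum I) => [|i r IH].
  by under eq_fun do rewrite big_nil; exact: measurable_cst.
under eq_fun do rewrite big_cons.
by case: (Q i) => //; apply: measurable_funM => //; exact: comp_measurable.
Qed.

Let indic_comp_integrable i A : measurable A ->
  P.-integrable setT (fun w => (\1_A (X i w) : R)%:E).
Proof.
move=> mA.
have -> : (fun w => (\1_A (X i w) : R)%:E) = (fun w => (\1_(X i @^-1` A) w)%:E).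
  by apply/funext => w; rewrite !indicE.
apply: integrable_indic => //.
by rewrite -[_ @^-1` _]setTI; exact: measurable_funP.
Qed.

Let Ex_indic_comp i A : measurable A ->
  (\int[P]_w (\1_A (X i w))%:E = P (X i @^-1` A))%E.
Proof.
move=> mA; under eq_integral => w _ do
  rewrite (_ : \1_A (X i w) = \1_(X i @^-1` A) w :> R) ?indicE//.
rewrite integral_indic//= ?setIT//.
by rewrite -[_ @^-1` _]setTI; exact: measurable_funP.
Qed.

Lemma ge0_integral_prod_indep (f : I -> R -> R) :
  (forall i, measurable_fun setT (f i)) -> (forall i y, 0 <= f i y) ->
  (forall i, P.-integrable setT (fun w => (f i (X i w))%:E)) ->
  (\int[P]_w (\prod_i f i (X i w))%:E)%E = (\prod_i Ex (fun w => f i (X i w)))%:E.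
Proof.
move=> mf f0 intf.
(* Vacuous for the full enumeration, this is the invariant of the induction. *)
have : forall i, i \notin enum I -> exists2 A, measurable A & f i = \1_A.
  by move=> i; rewrite mem_enum.
elim: (enum I) f mf f0 intf => [|j r IH] f mf f0 intf fr.
  have /choice[A AP] : forall i, exists A, measurable A /\ f i = \1_A.
    by move=> i; have [//|A] := fr i; exists A.
  have mA i : measurable (A i) := (AP i).1.
  have fA i : f i = \1_(A i) := (AP i).2.
  transitivity (\int[P]_w (\1_(\bigcap_(i in [set: I]) (X i @^-1` A i)) w)%:E)%E.
    apply: eq_integral => w _; congr EFin; rewrite indicE.
    have [Aw|/existsNP[i Aiw]] := pselect (forall i, A i (X i w)).
      rewrite mem_set; last by move=> i _; exact: Aw.
      by rewrite big1// => i _; rewrite fA indicE mem_set.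
    rewrite memNset; last by move=> /(_ i Logic.I)/Aiw.
    by rewrite (bigD1 i)//= fA indicE memNset// mul0r.
  rewrite integral_indic//; last first.
    apply: fin_bigcap_measurable => [|i _]; first exact: finite_finset.
    by rewrite -[_ @^-1` _]setTI; exact: measurable_funP.
  rewrite setIT; have /= -> := indX mA; rewrite (big_morph EFin EFinM erefl).
  apply: eq_bigr => i _; rewrite fineK ?integrable_fin_num//.
  by rewrite -Ex_indic_comp// fA.
have mE i : (0 <= Ex (fun w => f i (X i w))).
  by apply/fine_ge0/integral_ge0 => w _; rewrite lee_fin.
have c0 : 0 <= \prod_(i | i != j) Ex (fun w => f i (X i w)) by exact: prodr_ge0.
pose h w := \prod_(i | i != j) f i (X i w).
have h0 w : 0 <= h w by exact: prodr_ge0.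
(* The induction hypothesis, with [f j] replaced by an indicator, shows that weighting [P] by the
   other factors multiplies the law of [X j] by a constant. *)
have key (A : set R) : measurable A -> (\int[P]_w (h w * \1_A (X j w))%:E =
    mscale (NngNum c0) (distribution P (X j)) A)%E.
  move=> mA; pose f' i := if i == j then \1_A : R -> R else f i.
  have f'j i : i != j -> f' i = f i by rewrite /f' => /negbTE ->.
  have f'jj : f' j = \1_A by rewrite /f' eqxx.
  have mf' i : measurable_fun setT (f' i).
    by rewrite /f'; case: ifP => // _; exact: measurable_indic.
  have f'0 i y : 0 <= f' i y by rewrite /f'; case: ifP => // _; rewrite indicE.
  have intf' i : P.-integrable setT (fun w => (f' i (X i w))%:E).
    by rewrite /f'; case: eqP => // _; exact: indic_comp_integrable.
  have f'r i : i \notin r -> exists2 B, measurable B & f' i = \1_B.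
    move=> ir; rewrite /f'; case: eqP => [_|/eqP ij]; first by exists A.
    by apply: fr; rewrite inE negb_or ij.
  have := IH f' mf' f'0 intf' f'r.
  under eq_integral => w _ do rewrite (bigD1 j)//= f'jj mulrC.
  rewrite (bigD1 j)//= f'jj Ex_indic_comp// mulrC EFinM.
  rewrite fineK ?fin_num_measure//; last first.
    by rewrite -[_ @^-1` _]setTI; exact: measurable_funP.
  under eq_bigr => i ij do rewrite f'j//.
  rewrite /mscale/= /distribution /pushforward => <-.
  apply: eq_integral => w _; congr (_ * _)%:E.
  by apply: eq_bigr => i ij; rewrite f'j.
under eq_integral => w _ do rewrite (bigD1 j)//= mulrC.
rewrite (ge0_integral_density _ _ _ key)//; last exact: prod_measurable.
rewrite ge0_integral_mscale//; last 2 first.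
- exact/measurable_EFinP.
- by move=> y _; rewrite lee_fin.
rewrite ge0_integral_distribution//; last 2 first.
- exact/measurable_EFinP.
- by move=> y; rewrite lee_fin.
rewrite [in RHS](bigD1 j)//= mulrC EFinM fineK//.
exact: integrable_fin_num.
Qed.

(** Each factor is split into positive and negative parts and the product is expanded over all
    choices [c] of parts, so that the nonnegative case applies to each term. *)
Lemma expectation_prod_indep (f : I -> R -> R) :
  (forall i, measurable_fun setT (f i)) ->
  (forall i, P.-integrable setT (fun w => (f i (X i w))%:E)) ->
  P.-integrable setT (fun w => (\prod_i f i (X i w))%:E) /\
  Ex (fun w => \prod_i f i (X i w)) = \prod_i Ex (fun w => f i (X i w)).
Proof.
move=> mf intf; pose g i b y := Num.max (if b then f i y else - f i y) 0.
have g0 i b y : 0 <= g i b y by rewrite le_max lexx orbT.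
have mg i b : measurable_fun setT (g i b).
  apply: measurable_maxr => //; case: b => //.
  exact: measurableT_comp.
have intg i b : P.-integrable setT (fun w => (g i b (X i w))%:E).
  apply: le_integrable (intf i) => //.
    by apply/measurable_EFinP; exact: measurableT_comp.
  move=> w _; rewrite lee_fin ger0_norm// ge_max normr_ge0 andbT.
  by case: b; rewrite ?ler_norm// -normrN ler_norm.
have fE i y : f i y = \sum_b (-1) ^+ (~~ b) * g i b y.
  rewrite big_bool/= expr0 expr1 mul1r mulN1r /g/=.
  have /orP[h|h] := le_total 0 (f i y).
    by rewrite max_l// max_r ?oppr_le0// subr0.
  by rewrite max_r// max_l ?oppr_ge0// sub0r opprK.
have intp (c : {ffun I -> bool}) :
    P.-integrable setT (fun w => (\prod_i g i (c i) (X i w))%:E).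
  apply/integrableP; split.
    by apply/measurable_EFinP; exact: (@prod_measurable (fun i => g i (c i))).
  under eq_integral => w _ do rewrite /= ger0_norm ?prodr_ge0//.
  by rewrite (@ge0_integral_prod_indep (fun i => g i (c i)))// ltry.
have prodE w : (\prod_i f i (X i w))%:E =
  (\sum_(c : {ffun I -> bool})
    ((\prod_i (-1) ^+ (~~ c i))%:E * (\prod_i g i (c i) (X i w))%:E))%E.
  under eq_bigr do rewrite fE.
  rewrite bigA_distr_bigA/= sumEFin; congr EFin.
  by apply: eq_bigr => c _; rewrite big_split.
have -> : (fun w => (\prod_i f i (X i w))%:E) = (fun w => \sum_(c : {ffun I -> bool})
  ((\prod_i (-1) ^+ (~~ c i))%:E * (\prod_i g i (c i) (X i w))%:E))%E by apply/funext.
split.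
  by apply: integrable_sum => // c _; exact: integrableZl.
rewrite integral_sum//; last by move=> c; exact: integrableZl.
rewrite (eq_bigr (fun c : {ffun I -> bool} =>
    (\prod_i ((-1) ^+ (~~ c i) * Ex (fun w => g i (c i) (X i w))))%:E)); last first.
  move=> c _; rewrite integralZl//.
  by rewrite (@ge0_integral_prod_indep (fun i => g i (c i)))// -EFinM big_split.
rewrite sumEFin/=.
rewrite -(bigA_distr_bigA (fun i b => (-1) ^+ (~~ b) * Ex (fun w => g i b (X i w)))).
apply: eq_bigr => i _.
under [in RHS]eq_integral do rewrite fE big_bool/= expr0 expr1 mul1r mulN1r EFinD EFinN.
rewrite integralB// fineB ?integrable_fin_num//.
by rewrite big_bool/= expr0 expr1 mul1r mulN1r.
Qed.

End independence.

(** * Moments of the normal law *)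

Section gauss.
Variable R : realType.
Local Notation leb := (@lebesgue_measure R).

(** On [[-(n+1), n+1]] the fundamental theorem of calculus leaves two boundary values of size at
    most [K / (n+1)]; dominated convergence passes to the whole line. *)
Lemma integral_derivative_eq0 (F f : R -> R) (K : R) :
  (forall x : R, is_derive x 1 F (f x)) -> continuous f ->
  leb.-integrable setT (fun x => (f x)%:E) ->
  (forall x, `|x * F x| <= K) ->
  (\int[leb]_x (f x)%:E = 0)%E.
Proof.
move=> dF cf intf FK.
pose D (n : nat) : set R := `[- n.+1%:R, n.+1%:R]%classic.
pose f_ n := (fun x => (f x)%:E) \_ (D n).
have mf : measurable_fun setT (fun x => (f x)%:E) by exact: measurable_int intf.
have mf_ n : measurable_fun setT (f_ n).
  apply/(measurable_restrictT _ _).1 => //; first exact: measurable_itv.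
  exact: measurable_funTS.
have cvg1 : (\int[leb]_x f_ n x @[n --> \oo] --> \int[leb]_x (f x)%:E)%E.
  have [|||_ _ //] := @dominated_convergence _ _ R leb setT measurableT f_
    (fun x => (f x)%:E) (fun x => `|(f x)%:E|%E) mf_ mf.
  - apply: aeW => x _; apply: cvg_near_cst.
    have := nbhs_infty_ger `|x|; apply: filterS => n xn.
    rewrite /f_ patchE ifT// inE /D/= in_itv/= -ler_norml.
    by rewrite (le_trans xn)// ler_nat.
  - exact: integrable_abse.
  - apply: aeW => x n _; rewrite /f_ patchE; case: ifP => // _.
    by rewrite abse0.
have intE n : (\int[leb]_x f_ n x = (F n.+1%:R - F (- n.+1%:R))%:E)%E.
  rewrite /f_ -integral_mkcond EFinB; apply: continuous_FTC2.
  - by rewrite -subr_gt0 opprK -natrD ltr0n.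
  - exact: continuous_subspaceT.
  - have cF : continuous F by move=> x; apply/differentiable_continuous/derivable1_diffP.
    split=> [x _||]; first exact: ex_derive.
      exact/cvg_at_right_filter/cF.
    exact/cvg_at_left_filter/cF.
  - by move=> x _; rewrite derive1E; apply: derive_val.
have bnd n : `|F n.+1%:R - F (- n.+1%:R)| <= (K *+ 2) * n.+1%:R^-1.
  have b x : x != 0 -> `|F x| <= K * `|x|^-1.
    by move=> x0; rewrite ler_pdivlMr ?normr_gt0// -normrM mulrC FK.
  rewrite (le_trans (ler_normB _ _))// mulrnAl mulr2n lerD//.
    by rewrite (le_trans (b _ _)) ?pnatr_eq0// normr_nat.
  by rewrite (le_trans (b _ _)) ?oppr_eq0 ?pnatr_eq0// normrN normr_nat.
have cvg0 : ((F n.+1%:R - F (- n.+1%:R)) @[n --> \oo] --> 0).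
  apply/norm_cvg0P.
  apply: (@squeeze_cvgr _ _ _ _ (cst 0) (fun n => (K *+ 2) * n.+1%:R^-1)).
  - by near=> n; rewrite normr_ge0/= bnd.
  - exact: cvg_cst.
  - rewrite -[X in _ --> X](mulr0 (K *+ 2)); apply: cvgM; first exact: cvg_cst.
    exact: cvg_harmonic.
have cvg2 : (\int[leb]_x f_ n x @[n --> \oo] --> 0)%E.
  by under eq_fun do rewrite intE; apply: cvg_EFin; first exact: nearW.
exact: (cvg_unique _ cvg1 cvg2).
Unshelve. all: by end_near. Qed.

Lemma exprn_le_expR (k : nat) (y : R) : 0 <= y -> y ^+ k <= k.+1%:R ^+ k * expR y.
Proof.
(* Dividing by [k.+1] instead of [k] covers [k = 0]; then [z <= expR z] and [k z <= y] suffice. *)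
move=> y0; pose z := y / k.+1%:R.
have yz : y = k.+1%:R * z by rewrite mulrC divfK ?pnatr_eq0.
have z0 : 0 <= z by rewrite divr_ge0.
rewrite [in leLHS]yz exprMn ler_wpM2l ?exprn_ge0//.
apply: (@le_trans _ _ (expR z ^+ k)).
  by apply: lerXn2r; rewrite ?nnegrE ?expR_ge0// (le_trans _ (expR_ge1Dx _))// lerDr.
rewrite -expRM_natl ler_expR yz ler_wpM2r// ler_nat; lia.
Qed.

Variable sigma : R.
Hypothesis sigma0 : sigma != 0.
Local Notation pdf := (normal_pdf 0 sigma).

(** Doubling the variance halves the exponent of the density; the other half absorbs the powers of
    [x]. *)
Let tau := sigma * Num.sqrt 2.

Let tau0 : tau != 0.
Proof. by rewrite mulf_neq0// sqrtr_eq0 -ltNge. Qed.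

Lemma exprn_normal_pdf_le k : exists2 C, 0 <= C &
  forall x, `|x| ^+ k * pdf x <= C * normal_pdf 0 tau x.
Proof.
have s0 : 0 < sigma ^+ 2 by rewrite exprn_even_gt0.
have tauE : tau ^+ 2 = sigma ^+ 2 * 2 by rewrite exprMn sqr_sqrtr.
(* [C1] combines [|x|^k <= 1 + x^(2k)] with [exprn_le_expR] at [y = x^2 / (4 sigma^2)]. *)
pose C1 := 1 + (sigma ^+ 2 * 4) ^+ k * k.+1%:R ^+ k.
have C10 : 0 <= C1 by rewrite addr_ge0// mulr_ge0 ?exprn_ge0// mulr_ge0// ltW.
exists (C1 * normal_peak sigma / normal_peak tau).
  by rewrite divr_ge0 ?normal_peak_ge0// mulr_ge0 ?normal_peak_ge0.
move=> x; rewrite !normal_pdfE//= -[leRHS]mulrA mulKf ?gt_eqF ?normal_peak_gt0//.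
rewrite mulrCA [C1 * _]mulrC -[leRHS]mulrA ler_wpM2l ?normal_peak_ge0//.
rewrite /normal_fun subr0; pose y := x ^+ 2 / (sigma ^+ 2 * 4).
have y0 : 0 <= y by rewrite divr_ge0 ?sqr_ge0// mulr_ge0// ltW.
have -> : - x ^+ 2 / (tau ^+ 2 *+ 2) = - y.
  by rewrite tauE /y; field; rewrite sigma0.
have -> : - x ^+ 2 / (sigma ^+ 2 *+ 2) = - y - y.
  by rewrite /y; field; rewrite sigma0.
rewrite expRD mulrA ler_wpM2r ?expR_ge0// expRN ler_pdivrMr ?expR_gt0//.
apply: (@le_trans _ _ (1 + y ^+ k * (sigma ^+ 2 * 4) ^+ k)).
  rewrite -exprMn divfK; last by rewrite gt_eqF// mulr_gt0.
  rewrite -normrX -real_normK ?num_real// -exprM mulnC exprM.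
  have : 0 <= `|x| ^+ k by rewrite exprn_ge0.
  rewrite -normrX.
  move: (`|x ^+ k|) => u u0; nra.
rewrite /C1 mulrDl mul1r lerD//.
  by rewrite -[leLHS]expR0 ler_expR.
rewrite [leLHS]mulrC -[leRHS]mulrA ler_wpM2l ?exprn_le_expR//.
by rewrite exprn_ge0// mulr_ge0// ltW.
Qed.

Lemma measurable_exprn_pdf k : measurable_fun setT (fun x : R => x ^+ k * pdf x).
Proof.
by apply: measurable_funM; [exact: measurable_funX | exact: measurable_normal_pdf].
Qed.

Lemma integrable_exprn_pdf k :
  leb.-integrable setT (fun x => (x ^+ k * pdf x)%:E).
Proof.
have [C C0 le] := exprn_normal_pdf_le k.
have : leb.-integrable setT (fun x => C%:E * (normal_pdf 0 tau x)%:E)%E.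
  by apply: integrableZl => //; exact: integrable_normal_pdf.
apply: le_integrable => //.
- apply/measurable_EFinP; exact: measurable_exprn_pdf.
- move=> x _; rewrite -EFinM lee_fin [leLHS]normrM normrX.
  rewrite (ger0_norm (normal_pdf_ge0 _ _ _)).
  by rewrite [leRHS]ger0_norm// mulr_ge0 ?normal_pdf_ge0.
Qed.

Lemma is_derive_normal_pdf (x : R) :
  is_derive x 1 pdf (- x / sigma ^+ 2 * pdf x).
Proof.
rewrite normal_pdfE//.
pose u (y : R) := - (y - 0) ^+ 2 / (sigma ^+ 2 *+ 2).
have du : is_derive x 1 u (- x / sigma ^+ 2).
  have -> : u = (fun y : R => - (sigma ^+ 2 *+ 2)^-1 * (y ^+ 2)).
    by apply/funext => y; rewrite /u subr0 mulNr mulNr mulrC.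
  apply: is_derive_eq; rewrite /GRing.scale/=.
  by field; rewrite sigma0.
have dg : is_derive x 1 (expR \o u) (expR (u x) * (- x / sigma ^+ 2)).
  exact: is_derive1_comp.
have -> : (fun y => normal_peak sigma * normal_fun 0 sigma y) =
    (fun y => normal_peak sigma * (expR \o u) y) by [].
apply: is_derive_eq; rewrite /GRing.scale/= /normal_fun -/(u x); ring.
Qed.

(** Integration by parts: the derivative of [x ^+ k * pdf x] has integral 0. For [k = 0] the
    right-hand side vanishes through its factor [k%:R]. *)
Lemma normal_moment_rec k :
  (\int[leb]_x (x ^+ k.+1 * pdf x)%:E =
    (k%:R * sigma ^+ 2)%:E * \int[leb]_x (x ^+ k.-1 * pdf x)%:E)%E.
Proof.
pose F x := x ^+ k * pdf x.
pose f x := k%:R * (x ^+ k.-1 * pdf x) - (sigma ^+ 2)^-1 * (x ^+ k.+1 * pdf x).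
have dF (x : R) : is_derive x 1 F (f x).
  have dp := is_derive_normal_pdf x.
  have dX : is_derive x 1 (fun y : R => y ^+ k) (k%:R * x ^+ k.-1).
    have -> : (fun y : R => y ^+ k) = (@id R) ^+ k.
      by apply/funext => y; rewrite fctE.
    apply: (is_derive_eq (is_deriveX k (is_derive_id x 1))).
    by rewrite /GRing.scale/= mulr1.
  apply: (is_derive_eq (is_deriveM dX dp)); rewrite /GRing.scale/= /f (exprS x k).
  by field; rewrite sigma0.
have cpdf : continuous pdf by exact: continuous_normal_pdf.
have cp j : continuous (fun x : R => x ^+ j * pdf x).
  by move=> x; apply: cvgM; [exact: exprn_continuous|exact: cpdf].
have cf : continuous f.
  by move=> x; apply: cvgB; apply: cvgM => //; try exact: cvg_cst; exact: cp.
have int1 : leb.-integrable setT (fun x => (k%:R%:E * (x ^+ k.-1 * pdf x)%:E)%E).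
  by apply: integrableZl => //; exact: integrable_exprn_pdf.
have int2 : leb.-integrable setT
    (fun x => (((sigma ^+ 2)^-1)%:E * (x ^+ k.+1 * pdf x)%:E)%E).
  by apply: integrableZl => //; exact: integrable_exprn_pdf.
have intf : leb.-integrable setT (fun x => (f x)%:E).
  by under eq_fun do rewrite EFinB !EFinM -!EFinM; exact: integrableB.
have [C C0 le] := exprn_normal_pdf_le k.+1.
have FK x : `|x * F x| <= C * normal_peak tau.
  rewrite mulrA -exprS normrM normrX (ger0_norm (normal_pdf_ge0 _ _ _)).
  by rewrite (le_trans (le x))// ler_wpM2l// normal_pdf_ub.
have := integral_derivative_eq0 dF cf intf FK.
under eq_integral do rewrite EFinB EFinM [X in (_ - X)%E]EFinM.
rewrite integralB// integralZl//; last exact: integrable_exprn_pdf.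
rewrite integralZl//; last exact: integrable_exprn_pdf.
have fin j : (\int[leb]_x (x ^+ j * pdf x)%:E)%E \is a fin_num.
  by apply: integrable_fin_num => //; exact: integrable_exprn_pdf.
rewrite -(fineK (fin k.+1)) -(fineK (fin k.-1)) -!EFinM -EFinB => -[].
move: (fine _) (fine _) => a b ab; congr EFin.
have := congr1 ( *%R (sigma ^+ 2)) ab; rewrite mulr0 mulrBr mulVKf ?expf_neq0//.
by move=> /eqP; rewrite subr_eq0 => /eqP <-; ring.
Qed.

Lemma normal_moment k :
  (\int[leb]_x (x ^+ k * pdf x)%:E = (gauss_moment (sigma ^+ 2) k)%:E)%E.
Proof.
have [m] := ubnP k; elim: m k => // m IH [|k] km.
  by under eq_integral do rewrite expr0 mul1r; rewrite integral_normal_pdf.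
rewrite normal_moment_rec gauss_momentS EFinM IH//; lia.
Qed.

End gauss.

(** * The matrix of moments *)

Section normal_variable.
Context d (Omega : measurableType d) (R : realType) (P : probability Omega R).
Variables (X : {RV P >-> R}) (sigma : R).
Hypotheses (lawX : has_normal_law X sigma) (sigma0 : sigma != 0).

Let ge0_integral_normal (g : R -> R) : measurable_fun setT g ->
  (forall y, 0 <= g y) ->
  (\int[P]_w (g (X w))%:E = \int[lebesgue_measure]_x (g x * normal_pdf 0 sigma x)%:E)%E.
Proof.
move=> mg g0.
transitivity (\int[distribution P X]_y (g y)%:E)%E.
  rewrite ge0_integral_distribution//; exact/measurable_EFinP.
under [RHS]eq_integral do rewrite mulrC.
apply/esym/(@ge0_integral_density _ _ _ _ R lebesgue_measure (distribution P X) id) => //.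
- exact: measurable_normal_pdf.
- by move=> x; exact: normal_pdf_ge0.
move=> A mA; rewrite -[RHS]/(distribution P X A) (lawX mA) /normal_prob.
rewrite [RHS]integral_mkcond.
by apply: eq_integral => x _; rewrite patchE indicE; case: ifP; rewrite ?mulr1 ?mulr0.
Qed.

Lemma normal_variable_moment k :
  P.-integrable setT (fun w => (X w ^+ k)%:E) /\
  fine (\int[P]_w (X w ^+ k)%:E)%E = gauss_moment (sigma ^+ 2) k.
Proof.
have mXk : measurable_fun setT (fun w => X w ^+ k) by exact: measurable_funX.
split.
  apply/integrableP; split; first exact/measurable_EFinP.
  under eq_integral do rewrite /=.
  rewrite (@ge0_integral_normal (fun y => `|y ^+ k|))//; last first.
    by apply: measurableT_comp => //; exact: measurable_funX.
  have /integrableP[_] := integrable_exprn_pdf sigma0 k.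
  apply: le_lt_trans; rewrite le_eqVlt; apply/orP; left; apply/eqP.
  apply: eq_integral => x _; rewrite /= normrM.
  by rewrite (ger0_norm (normal_pdf_ge0 _ _ _)).
have -> : (\int[P]_w (X w ^+ k)%:E =
    \int[lebesgue_measure]_x (x ^+ k * normal_pdf 0 sigma x)%:E)%E.
  (* The transfer to the density covers nonnegative integrands, so positive and negative parts are
     treated apart. *)
  rewrite integralE [RHS]integralE; congr (_ - _)%E.
    rewrite (eq_integral (fun w => (Num.max (X w ^+ k) 0)%:E)); last first.
      by move=> w _; rewrite funeposE EFin_max.
    rewrite (@ge0_integral_normal (fun y => Num.max (y ^+ k) 0)).
    - apply: eq_integral => x _; rewrite funeposE -EFin_max.
      by rewrite maxr_pMl ?normal_pdf_ge0// mul0r.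
    - by apply: measurable_maxr => //; exact: measurable_funX.
    - by move=> y; rewrite le_max lexx orbT.
  rewrite (eq_integral (fun w => (Num.max (- X w ^+ k) 0)%:E)); last first.
    by move=> w _; rewrite funenegE -EFinN EFin_max.
  rewrite (@ge0_integral_normal (fun y => Num.max (- y ^+ k) 0)).
  - apply: eq_integral => x _; rewrite funenegE -EFinN -EFin_max.
    by rewrite maxr_pMl ?normal_pdf_ge0// mul0r mulNr.
  - apply: measurable_maxr => //.
    exact: (@measurableT_comp _ _ _ _ _ _ (@GRing.opp R)).
  - by move=> y; rewrite le_max lexx orbT.
by rewrite normal_moment.
Qed.

End normal_variable.

Section moment_matrix_entries.
Context d (Omega : measurableType d) (R : realType) (P : probability Omega R).
Variables (N : nat) (W : 'I_N -> 'I_N -> {RV P >-> R}) (sigma : R).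
Hypothesis indW :
  mutually_independent P (fun ij : 'I_N * 'I_N => (W ij.1 ij.2 : Omega -> R)).
Hypothesis lawW : forall i j, has_normal_law (W i j) sigma.
Hypothesis sigma0 : sigma != 0.

Local Notation Ex f := (fine (\int[P]_w (f w)%:E)%E).
Local Notation integ f := (P.-integrable setT (fun w => (f w)%:E)).
Local Notation word := (seq ('I_N * 'I_N)).
Local Notation v := (sigma ^+ 2).

Lemma prod_count (I : finType) (x : I -> R) (s : seq I) :
  \prod_(e <- s) x e = \prod_e x e ^+ count_mem e s.
Proof.
elim: s => [|a s IH]; first by rewrite big_nil big1.
rewrite big_cons IH (bigD1 a)//= [RHS](bigD1 a)//= eqxx add1n exprS mulrA.
by congr (_ * _); apply: eq_bigr => e ea; rewrite eq_sym (negbTE ea).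
Qed.

(** Repeated edges are grouped into powers of one entry of [W], so independence factorises over
    distinct edges. Integrability is recorded as well, to let expectations pass through the sums
    below. *)
Lemma expectation_word (s : word) :
  integ (fun w => \prod_(e <- s) W e.1 e.2 w) /\
  Ex (fun w => \prod_(e <- s) W e.1 e.2 w) = wick v s.
Proof.
pose f (e : 'I_N * 'I_N) (y : R) := y ^+ count_mem e s.
have mf e : measurable_fun setT (f e) by exact: measurable_funX.
have [] := expectation_prod_indep (X := fun e => W e.1 e.2) indW mf.
  by move=> e; have [] := normal_variable_moment (lawW e.1 e.2) sigma0 (count_mem e s).
have -> : (fun w => (\prod_(e <- s) W e.1 e.2 w)%:E) =
    (fun w => (\prod_e f e (W e.1 e.2 w))%:E).
  by apply/funext => w; rewrite (prod_count (fun e => W e.1 e.2 w)).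
move=> int ->; split=> //; apply: eq_bigr => e _.
by have [_] := normal_variable_moment (lawW e.1 e.2) sigma0 (count_mem e s).
Qed.

Lemma expectation_sum_fin (I : finType) (f : I -> Omega -> R) :
  (forall i, integ (f i)) ->
  integ (fun w => \sum_i f i w) /\ Ex (fun w => \sum_i f i w) = \sum_i Ex (f i).
Proof.
move=> intf.
have E : (fun w => (\sum_i f i w)%:E) = (fun w => \sum_i (f i w)%:E)%E.
  by apply/funext => w; rewrite sumEFin.
rewrite E; split; first by apply: integrable_sum => // i _; exact: intf.
rewrite integral_sum// (eq_bigr (fun i => (Ex (f i))%:E)) ?sumEFin// => i _.
by rewrite fineK// integrable_fin_num.
Qed.

Lemma expectation_path_sum l i (G : word -> 'I_N -> Omega -> R) :
  (forall s j, integ (G s j)) ->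
  integ (fun w => path_sum l i (fun s j => G s j w)) /\
  Ex (fun w => path_sum l i (fun s j => G s j w)) =
    path_sum l i (fun s j => Ex (G s j)).
Proof.
elim: l i G => [|l IH] i G intG /=; first by split.
have IHj j := IH j (fun s => G ((i, j) :: s)) (fun s => intG _).
have [int ->] := expectation_sum_fin (fun j => (IHj j).1).
by split=> //; apply: eq_bigr => j _; exact: (IHj j).2.
Qed.

Let beta_product l1 l2 w := \sum_(i < N) beta (fun a b => W a b w) l1 i
                                      * beta (fun a b => W a b w) l2 i.

Lemma expectation_beta_product l1 l2 :
  integ (beta_product l1 l2) /\ Ex (beta_product l1 l2) = wick_moment N v l1 l2.
Proof.
have bE i w : beta (fun a b => W a b w) l1 i * beta (fun a b => W a b w) l2 i =
    path_sum l1 i (fun s _ => path_sum l2 i (fun t _ =>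
      \prod_(e <- s ++ t) W e.1 e.2 w)).
  rewrite !beta_path_sum mulrC -path_sumZ; apply: eq_path_sum => s _.
  rewrite mulrC -path_sumZ; apply: eq_path_sum => t _.
  by rewrite big_cat.
have -> : beta_product l1 l2 = (fun w => \sum_i
    path_sum l1 i (fun s _ => path_sum l2 i (fun t _ =>
      \prod_(e <- s ++ t) W e.1 e.2 w))).
  by apply/funext => w; apply: eq_bigr => i _; exact: bE.
have H2 i (s : word) := expectation_path_sum l2 i
   (G := fun t _ w => \prod_(e <- s ++ t) W e.1 e.2 w)
   (fun t _ => (expectation_word (s ++ t)).1).
have H1 i := expectation_path_sum l1 i (fun s _ => (H2 i s).1).
have [int E] := expectation_sum_fin (fun i => (H1 i).1).
split=> //; apply: (etrans E); apply: eq_bigr => i _; rewrite (H1 i).2.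
apply: eq_path_sum => s _; rewrite (H2 i s).2.
by apply: eq_path_sum => t _; rewrite (expectation_word (s ++ t)).2.
Qed.

Lemma moment_matrixE T (l1 l2 : 'I_T.+1) :
  moment_matrix W T l1 l2 = wick_moment N v l1 l2.
Proof.
by rewrite mxE unlock; exact: (expectation_beta_product l1 l2).2.
Qed.

Lemma moment_matrix_sym T : (moment_matrix W T)^T = moment_matrix W T.
Proof.
apply/matrixP => i j; rewrite !mxE; congr (fine (expectation _ _)).
by apply/funext => w; apply: eq_bigr => k _; rewrite mulrC.
Qed.

(** The quadratic form is the expectation of a sum of squares: the matrix is a Gram matrix. *)
Lemma moment_matrix_psd T (u : 'rV[R]_T.+1) :
  0 <= (u *m moment_matrix W T *m u^T) 0 0.
Proof.
pose B w := \sum_i (\sum_(l < T.+1) u 0 l * beta (fun a b => W a b w) l i) ^+ 2.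
suff -> : (u *m moment_matrix W T *m u^T) 0 0 = Ex B.
  apply/fine_ge0/integral_ge0 => w _; rewrite lee_fin sumr_ge0// => i _.
  exact: sqr_ge0.
pose f (p : 'I_T.+1 * 'I_T.+1) w := (u 0 p.1 * u 0 p.2) * beta_product p.1 p.2 w.
have intf p : integ (f p).
  rewrite /f; under eq_fun do rewrite EFinM.
  by apply: integrableZl => //; exact: (expectation_beta_product _ _).1.
have -> : B = (fun w => \sum_p f p w).
  apply/funext => w; rewrite /B /f; under eq_bigr do rewrite expr2 big_distrlr/=.
  rewrite exchange_big/=.
  rewrite -(pair_bigA _ (fun l1 l2 => u 0 l1 * u 0 l2 * beta_product l1 l2 w))/=.
  apply: eq_bigr => l1 _; rewrite exchange_big/=; apply: eq_bigr => l2 _.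
  rewrite /beta_product big_distrr/=; apply: eq_bigr => i _; ring.
rewrite (expectation_sum_fin intf).2.
rewrite -(pair_bigA _ (fun l1 l2 => Ex (f (l1, l2))))/= exchange_big/=.
rewrite mxE; apply: eq_bigr => l2 _; rewrite !mxE big_distrl/=.
apply: eq_bigr => l1 _; rewrite moment_matrixE /f/=.
under eq_integral do rewrite EFinM.
have [int E] := expectation_beta_product l1 l2.
by rewrite integralZl// fineM ?integrable_fin_num//= E; ring.
Qed.

End moment_matrix_entries.

(** * Growing sequences and the spectral ratio *)

Section growing_sequences.
Variables (R : realType) (b : nat -> R).

(** Iterating the hypothesis bounds the term [k] places before the last by [q ^+ k * b T]. *)
Lemma sum_le_geometric (q : R) : 0 <= q -> (forall l, b l <= q * b l.+1) ->
  forall T, \sum_(l < T.+1) b l <= (\sum_(l < T.+1) q ^+ l) * b T.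
Proof.
move=> q0 bq; elim=> [|T IH]; first by rewrite !big_ord_recl !big_ord0 !addr0 expr0 mul1r.
rewrite big_ord_recr/= [in leRHS]big_ord_recl/= expr0 mulrDl mul1r [leRHS]addrC lerD2r.
apply: (le_trans IH); under [in leRHS]eq_bigr do rewrite exprS.
rewrite -big_distrr/= [q * _]mulrC -mulrA ler_wpM2l// sumr_ge0// => i _.
exact: exprn_ge0.
Qed.

(** The ratios [b l.+1 / b l] tend to infinity. Once they exceed 2, the quotient of the partial sum
    by its last term stays bounded; one further step with a large ratio brings it below [1 + e]. *)
Lemma sum_le_last (c e : R) : 0 < c -> 0 < e -> (forall l, 0 < b l) ->
  (forall l, c * l%:R * b l <= b l.+1) ->
  exists T0, forall T, (T0 <= T)%N -> \sum_(l < T.+1) b l <= (1 + e) * b T.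
Proof.
move=> c0 e0 b0 bc; pose S T := \sum_(l < T.+1) b l.
have SS T : S T.+1 = S T + b T.+1 by rewrite /S big_ord_recr.
have large x : exists n, forall l, (n <= l)%N -> x <= c * l%:R.
  exists (Num.bound `|x / c|) => l nl; rewrite mulrC -ler_pdivrMr//.
  rewrite (le_trans (ler_norm _))// (le_trans (ltW (archi_boundP (normr_ge0 _))))//.
  by rewrite ler_nat.
have [L HL] := large 2.
pose K := S L / b L.
have K0 : 0 <= K by apply: divr_ge0; [apply: sumr_ge0 => i _|]; exact: ltW.
have step T x : (L <= T)%N -> 0 <= x -> S T <= x * b T ->
  forall y, 0 < y -> y <= c * T%:R -> S T.+1 <= (1 + x / y) * b T.+1.
  move=> LT x0 ST y y0 yT; rewrite SS mulrDl mul1r addrC lerD2l.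
  apply: (le_trans ST); rewrite -mulrA ler_wpM2l// ler_pdivlMl//.
  by apply: le_trans (bc T); rewrite ler_wpM2r// ltW.
(* The bound [2 + K] reproduces itself, since [1 + (2 + K) / 2 <= 2 + K]. *)
have SK k : S (L + k)%N <= (2 + K) * b (L + k)%N.
  elim: k => [|k IH].
    by rewrite addn0 mulrDl divfK ?gt_eqF// lerDr mulr_ge0// ltW.
  rewrite addnS; apply: (le_trans (step _ _ (leq_addr _ _) _ IH 2 _ _)) => //.
  - by rewrite addr_ge0.
  - by apply: HL; rewrite leq_addr.
  - by apply: ler_wpM2r; [exact: ltW|lra].
(* A ratio of at least [(2 + K) / e] makes the excess over 1 equal to [e]; the threshold is a
   successor because [step] leads from [T] to [T.+1]. *)
have [M HM] := large ((2 + K) / e).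
exists (maxn L M).+1 => -[//|T]; rewrite ltnS geq_max => /andP[LT MT].
have K2 : 0 < 2 + K by rewrite ltr_wpDr.
have {1}-> : e = (2 + K) / ((2 + K) / e) by rewrite invf_div mulrCA mulfV ?mulr1// gt_eqF.
apply: (step T) => //; first exact: ltW.
- by rewrite -(subnKC LT) SK.
- by rewrite divr_gt0.
- exact: HM.
Qed.

End growing_sequences.

Theorem mainTheorem14 (R : realType) (N : nat) (sigma : R) :
  (0 < N)%N -> 0 < sigma ->
  (forall (d : measure_display) (Omega : measurableType d)
          (P : probability Omega R) (W : 'I_N -> 'I_N -> {RV P >-> R}),
     mutually_independent P (fun ij : 'I_N * 'I_N => (W ij.1 ij.2 : Omega -> R)) ->
     (forall i j, has_normal_law (W i j) sigma) ->
     forall (T : nat), (0 < T)%N ->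
     forall s : seq R, eigenvalues_seq (moment_matrix W T) s ->
       (P_bound sigma N T)^-1 <= seq_max s / \sum_(x <- s) x
       /\ seq_max s / \sum_(x <- s) x <= 1)
  /\
  (exists T0 : nat, (6 <= T0)%N /\
   forall (d : measure_display) (Omega : measurableType d)
          (P : probability Omega R) (W : 'I_N -> 'I_N -> {RV P >-> R}),
     mutually_independent P (fun ij : 'I_N * 'I_N => (W ij.1 ij.2 : Omega -> R)) ->
     (forall i j, has_normal_law (W i j) sigma) ->
     forall (T : nat), (T0 <= T)%N ->
     forall s : seq R, eigenvalues_seq (moment_matrix W T) s ->
       (Q_bound sigma N T)^-1 <= seq_max s / \sum_(x <- s) x).
Proof.
case: N => // n _ sigma_gt0; have sigma0 : sigma != 0 by rewrite gt_eqF.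
pose v := sigma ^+ 2; have v0 : 0 < v by rewrite exprn_gt0.
pose b l := wick_moment n.+1 v l l; pose q := (v * n.+1%:R)^-1.
have q0 : 0 < q by rewrite invr_gt0 mulr_gt0// ltr0n.
have bq l : b l <= q * b l.+1.
  rewrite ler_pdivlMl ?mulr_gt0 ?ltr0n//.
  by apply: wick_moment_prepend; exact: ltW.
have b_gt0 l : 0 < b l.
  elim: l => [|l IH]; first by rewrite /b wick_moment0 ltr0n.
  by have := lt_le_trans IH (bq l); rewrite pmulr_rgt0.
(* Both bounds reduce to this: any [K] that controls the trace by the last diagonal entry bounds the
   spectral ratio. *)
have ratio d (Omega : measurableType d) (P : probability Omega R)
    (W : 'I_n.+1 -> 'I_n.+1 -> {RV P >-> R}) :
  mutually_independent P (fun ij : 'I_n.+1 * 'I_n.+1 => (W ij.1 ij.2 : Omega -> R)) ->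
  (forall i j, has_normal_law (W i j) sigma) ->
  forall T (s : seq R), eigenvalues_seq (moment_matrix W T) s ->
  [/\ seq_max s / \sum_(x <- s) x <= 1,
      (T.+1%:R)^-1 <= seq_max s / \sum_(x <- s) x &
      forall K, 0 < K -> \sum_(l < T.+1) b l <= K * b T ->
        K^-1 <= seq_max s / \sum_(x <- s) x].
  move=> indW lawW T s eig.
  have trE : \sum_(x <- s) x = \sum_(l < T.+1) b l.
    rewrite (sum_eigenvalues eig); apply: eq_bigr => l _.
    by rewrite (moment_matrixE indW lawW).
  have tr0 : 0 < \sum_(x <- s) x.
    by rewrite trE big_ord_recl ltr_pwDl ?b_gt0// sumr_ge0// => l _; exact/ltW/b_gt0.
  have bmax : b T <= seq_max s.
    have := diag_le_seq_max eig ord_max (moment_matrix_sym W T).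
    by rewrite (moment_matrixE indW lawW).
  have le K : 0 < K -> \sum_(x <- s) x <= K * seq_max s ->
      K^-1 <= seq_max s / \sum_(x <- s) x.
    by move=> K0 h; rewrite ler_pdivlMr// ler_pdivrMl.
  split.
  - rewrite ler_pdivrMr// mul1r; apply: (seq_max_le_sum eig).
    by apply: (eigenvalues_ge0 eig) => u; exact: (moment_matrix_psd indW lawW).
  - by apply: le; rewrite ?ltr0n// (sum_le_seq_max eig).
  - move=> K K0 h; apply: le => //; rewrite trE (le_trans h)//.
    by rewrite ler_wpM2l// ltW.
split=> [d Omega P W indW lawW T _ s eig|].
  have [le1 leT leK] := ratio _ _ _ _ indW lawW _ _ eig; split=> //.
  (* The minimum is either [T.+1], a bound valid for any list of eigenvalues, or the geometric sum
     coming from [bq]. *)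
  rewrite /P_bound minEle; case: ifP => _ //; apply: leK.
    by rewrite big_ord_recl expr0 ltr_wpDr// sumr_ge0// => l _; rewrite exprn_ge0// ltW.
  by apply: sum_le_geometric => //; exact: ltW.
(* [m] is the leading factor of [Q_bound]; the growth lemma is used with [e = m - 1], so that
   [1 + e = m]. *)
pose m : R := Num.min 2 (1 + q).
have m1 : 0 < m - 1 by rewrite subr_gt0 lt_min [1 < 1 + q]ltrDl q0 andbT ltr1n.
pose c := v * 2 / n.+1%:R ^+ 2.
have c0 : 0 < c by rewrite divr_gt0 ?exprn_gt0 ?ltr0n// mulr_gt0.
have bc l : c * l%:R * b l <= b l.+1.
  have := @wick_moment_append R n v (ltW v0) l.
  rewrite -ler_pdivrMl ?exprn_gt0 ?ltr0n// /c -mul2n natrM => h.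
  by apply: le_trans h; rewrite le_eqVlt; apply/orP; left; apply/eqP; rewrite /b; ring.
have [T1 HT1] := sum_le_last c0 m1 b_gt0 bc.
exists (maxn 6 T1); split=> [|d Omega P W indW lawW T]; first by rewrite leq_max.
rewrite geq_max => /andP[T6 TT1] s eig.
have [_ _ leK] := ratio _ _ _ _ indW lawW _ _ eig.
(* For [T >= 6] both [T - 3] and [T - 5] are positive, so the second factor of [Q_bound] is at least
   1. *)
have mQ : m <= Q_bound sigma n.+1 T.
  have T6' : 6 <= T%:R :> R by rewrite ler_nat.
  rewrite /Q_bound -/v -/q -/m ler_peMr//; first by rewrite ltW// -subr_gt0; lra.
  rewrite -addrA lerDl addr_ge0//.
    rewrite invr_ge0 !mulr_ge0 ?exprn_ge0 ?divr_ge0 ?ltW//; lra.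
  by rewrite divr_ge0// !mulr_ge0 ?exprn_ge0 ?divr_ge0 ?ltW//; lra.
have Q0 : 0 < Q_bound sigma n.+1 T by apply: lt_le_trans mQ; lra.
apply: leK => //; apply: (le_trans (HT1 _ TT1)).
by rewrite addrC subrK ler_pM2r.
Qed.
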